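(* Let $A=[a_{ij}]$ be a symmetric $n\times n$ matrix with rational entries. The tropical quadratic form $y^T\odot A\odot y$ is PSD (i.e. $A\in\operatorname{trop}(\Sigma_n^* )$) if and only if the subdivision of $2\Delta_{n-1}$ induced by $A$ is trivial.
   Context: Tropical arithmetic on $\mathbb Q$: $a\oplus b=\min(a,b)$, $a\odot b=a+b$, extended to matrix products in the usual way. Let $R=\bigcup_{m\ge1}\mathbb R((t^{1/m}))$ be the field of real Puiseux series, with valuation $\operatorname{val}$ (lowest exponent of $t$ with nonzero coefficient) and the ordering where $a>b$ iff the leading coefficient of $a-b$ is positive. $\Sigma_n^*$ is the set of symmetric $n\times n$ matrices over $R$ with no zero entries all of whose principal minors are nonnegative, and $\operatorname{trop}(\Sigma_n^* )=\{\operatorname{val}(A):A\in\Sigma_n^*\}$ (entrywise valuation); its elements are called tropical PSD matrices. Symmetric matrices are identified with quadratic forms via $A\mapsto y^TAy$, and a tropical quadratic form is called PSD if it can be written as $y^T\odot A\odot y$ for some tropical PSD matrix $A$. $2\Delta_{n-1}=\{x\in\mathbb R^n_{\ge0}:\sum x_i=2\}$, with standard basis vectors $e_1,\dots,e_n$. The subdivision of $2\Delta_{n-1}$ induced by $A$: lift each point $e_i+e_j$ ($1\le i\le j\le n$) to height $a_{ij}$, take the convex hull of the lifted points in $\mathbb R^{n}\times\mathbb R$, and project its lower faces to $2\Delta_{n-1}$. The subdivision is trivial if it has a single maximal cell. *)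

(* Defs.v *)
From HB Require Import structures.
From mathcomp Require Import all_boot all_order all_algebra.
From mathcomp Require Import all_classical all_reals all_analysis.
From mathcomp Require Import ring lra.

Set Implicit Arguments.
Unset Strict Implicit.
Unset Printing Implicit Defensive.

Import Order.TTheory GRing.Theory Num.Theory.
Local Open Scope classical_set_scope.
Local Open Scope ring_scope.

Section Puiseux.
Variable R : realType.
Implicit Types (f g h : rat -> R).

(* f q is the coefficient of t^q: supp_in m N f says that f is a Laurent series
   in t^(1/m) whose exponents are all at least N/m *)
Definition supp_in (m : nat) (N : int) f : Prop :=
  forall q, f q != 0 -> exists2 k : int, N <= k & q = k%:~R / m%:R.

Definition is_puiseux : {pred rat -> R} :=
  fun f => `[< exists2 m : nat, (0 < m)%N & exists N : int, supp_in m N f >].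

Lemma is_puiseuxP f : reflect
  (exists2 m : nat, (0 < m)%N & exists N : int, supp_in m N f)
  (f \in is_puiseux).
Proof. exact: asboolP. Qed.

Lemma supp_in_widen m N m' N' f : (0 < m)%N -> (0 < m')%N ->
  N' <= - `|N| * m'%:Z ->
  supp_in m N f -> supp_in (m * m') N' f.
Proof.
move=> m0 m'0 NN fS q /fS[k Nk ->]; exists (k * m'%:Z).
  apply: (le_trans NN); apply: ler_wpM2r => //.
  by apply: le_trans Nk; rewrite lerNl -normrN; exact: ler_norm.
have m0' : (m%:R : rat) != 0 by rewrite pnatr_eq0 -lt0n.
have m0'' : (m'%:R : rat) != 0 by rewrite pnatr_eq0 -lt0n.
by rewrite intrM natrM -mulf_div divff ?mulr1.
Qed.

Lemma supp_in_common f g : f \in is_puiseux -> g \in is_puiseux ->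
  exists2 m : nat, (0 < m)%N & exists2 N, supp_in m N f & supp_in m N g.
Proof.
move=> /is_puiseuxP[m1 m10 [N1 f1]] /is_puiseuxP[m2 m20 [N2 g1]].
exists (m1 * m2)%N; first by rewrite muln_gt0 m10.
exists (Num.min (- `|N1| * m2%:Z) (- `|N2| * m1%:Z)).
  by apply: supp_in_widen f1 => //; rewrite ge_min lexx.
by rewrite mulnC; apply: supp_in_widen g1 => //; rewrite ge_min lexx orbT.
Qed.

Lemma is_puiseux_zmod : zmod_closed is_puiseux.
Proof.
split=> [|f g Pf Pg].
  by apply/is_puiseuxP; exists 1%N => //; exists 0 => q; rewrite eqxx.
apply/is_puiseuxP.
have [m m0 [N fS gS]] := supp_in_common Pf Pg.
exists m => //; exists N => q.
have [fq0|fq _] := eqVneq (f q) 0; last exact: fS.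
have [gq0|gq _] := eqVneq (g q) 0; last exact: gS.
by rewrite -[(f - g) q]/(f q - g q) fq0 gq0 subrr eqxx.
Qed.
HB.instance Definition _ :=
  GRing.isZmodClosed.Build _ is_puiseux is_puiseux_zmod.

Record puiseux := Puiseux { coefp :> rat -> R; _ : coefp \in is_puiseux }.
HB.instance Definition _ := [isSub for coefp].
HB.instance Definition _ := [Choice of puiseux by <:].
HB.instance Definition _ := [SubChoice_isSubZmodule of puiseux by <:].

Lemma finite_lattice (m : nat) (N : int) (x : rat) : finite_set
  [set q : rat | exists k : int, [/\ N <= k, k%:~R <= x & q = k%:~R / m%:R]].
Proof.
pose K := Num.bound `|x - N%:~R|.
apply: (@sub_finite_set _ _ ((fun i : nat => (N + i%:Z)%:~R / m%:R) @` `I_K)).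
  move=> q [k [Nk kx ->]].
  have kE : k = N + `|k - N|%N%:Z.
    by rewrite gez0_abs ?subr_ge0// subrKC.
  exists `|k - N|%N; last by rewrite -kE.
  rewrite /= -(ltr_nat rat); apply: (@le_lt_trans _ _ (x - N%:~R)).
    rewrite -[X in X <= _]/((`|k - N|%N%:Z)%:~R) gez0_abs ?subr_ge0//.
    by rewrite intrB lerB.
  by apply: le_lt_trans (archi_boundP (normr_ge0 _)); exact: ler_norm.
exact/finite_image/finite_II.
Qed.

Lemma fsum_finset (F : rat -> R) (P : set rat) :
  (forall a, F a != 0 -> P a) ->
  \sum_(a \in [set: rat]) F a = \sum_(a \in P) F a.
Proof.
move=> FP; apply/esym/fsbig_widen => // a [_ Pa] /=.
by apply/eqP; apply: contra_notT Pa; exact: FP.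
Qed.

Lemma fsum_neq0 (F : rat -> R) :
  \sum_(a \in [set: rat]) F a != 0 -> exists a, F a != 0.
Proof.
move=> F0; apply: contrapT => /forallNP FN; move/eqP: F0; apply.
by apply: fsbig1 => a _; apply/eqP; apply: contraT => /FN.
Qed.

Lemma exchange_fsum (F : rat -> rat -> R) (P Q : set rat) :
  finite_set P -> finite_set Q ->
  (forall a b, F a b != 0 -> P a /\ Q b) ->
  \sum_(a \in [set: rat]) \sum_(b \in [set: rat]) F a b =
  \sum_(b \in [set: rat]) \sum_(a \in [set: rat]) F a b.
Proof.
move=> finP finQ FPQ.
rewrite (@fsum_finset _ P); last first.
  by move=> a /fsum_neq0[b /FPQ[]].
rewrite [RHS](@fsum_finset _ Q); last first.
  by move=> b /fsum_neq0[a /FPQ[]].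
under eq_fsbigr do rewrite (@fsum_finset _ Q) => [|b /FPQ[]//].
under [RHS]eq_fsbigr do rewrite (@fsum_finset _ P) => [|b /FPQ[]//].
exact: exchange_fsbig.
Qed.

(* the coefficients of the Cauchy product; the sum has finite support as soon
   as f and g are Puiseux series *)
Definition mul_coef f g : rat -> R :=
  fun q => \sum_(a \in [set: rat]) f a * g (q - a).

Definition one_coef : rat -> R := fun q => (q == 0)%:R.

Lemma one_is_puiseux : one_coef \in is_puiseux.
Proof.
apply/is_puiseuxP; exists 1%N => //; exists 0 => q.
rewrite /one_coef; have [-> _|_] := eqVneq q 0; last by rewrite eqxx.
by exists 0 => //; rewrite mul0r.
Qed.

Lemma mul_coef_supp m N f g q a : supp_in m N f -> supp_in m N g ->
  f a * g (q - a) != 0 ->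
  exists k l : int, [/\ N <= k, N <= l, a = k%:~R / m%:R, q - a = l%:~R / m%:R
    & q = (k + l)%:~R / m%:R].
Proof.
move=> fS gS; rewrite mulf_eq0 negb_or => /andP[/fS[k Nk aE] /gS[l Nl bE]].
exists k, l; split=> //; rewrite intrD mulrDl -aE -bE; ring.
Qed.

Lemma mul_coef_finite m N f g q : (0 < m)%N ->
  supp_in m N f -> supp_in m N g ->
  finite_set [set a | f a * g (q - a) != 0].
Proof.
move=> m0 fS gS.
apply: sub_finite_set (finite_lattice m N (q * m%:R - N%:~R)) => a /=.
move=> /(mul_coef_supp fS gS)[k [l [Nk Nl aE bE qE]]]; exists k; split=> //.
rewrite qE mulfVK ?pnatr_eq0 -?lt0n// intrD -addrA lerDl subr_ge0.
by rewrite ler_int.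
Qed.

Lemma mul_is_puiseux f g : f \in is_puiseux -> g \in is_puiseux ->
  mul_coef f g \in is_puiseux.
Proof.
move=> Pf Pg; have [m m0 [N fS gS]] := supp_in_common Pf Pg.
apply/is_puiseuxP; exists m => //; exists (N + N) => q.
move=> /fsum_neq0[a /(mul_coef_supp fS gS)[k [l [Nk Nl _ _ qE]]]].
by exists (k + l) => //; exact: lerD.
Qed.

Lemma mul_coefC f g : mul_coef f g = mul_coef g f.
Proof.
apply/funext => q; rewrite /mul_coef (reindex_fsbigT (fun a => q - a)).
  by apply: eq_fsbigr => a _; rewrite subKr mulrC.
by exists (fun a => q - a) => a; rewrite subKr.
Qed.

Lemma mul_coef1 f : mul_coef one_coef f = f.
Proof.
apply/funext => q; rewrite /mul_coef (@fsum_finset _ [set 0]).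
  by rewrite fsbig_set1 /one_coef eqxx mul1r subr0.
by move=> a; rewrite /one_coef; have [->|_] := eqVneq a 0; rewrite ?mul0r ?eqxx.
Qed.

Lemma mul_coefDl f g h : f \in is_puiseux -> g \in is_puiseux ->
  h \in is_puiseux ->
  mul_coef (f + g) h = mul_coef f h + mul_coef g h.
Proof.
move=> Pf Pg Ph; apply/funext => q.
rewrite -[RHS]/(mul_coef f h q + mul_coef g h q) /mul_coef.
have [m m0 [N fS hS]] := supp_in_common Pf Ph.
have [m' m'0 [N' gS hS']] := supp_in_common Pg Ph.
set P := [set a | f a * h (q - a) != 0] `|` [set a | g a * h (q - a) != 0].
have finP : finite_set P.
  by rewrite finite_setU; split;
    [exact: mul_coef_finite fS hS|exact: mul_coef_finite gS hS'].
rewrite (@fsum_finset _ P); last first.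
  move=> a; rewrite -[(f + g) a]/(f a + g a) mulrDl => ne0.
  apply: contrapT => /not_orP[] /= /negP/negPn/eqP fa /negP/negPn/eqP ga.
  by move: ne0; rewrite fa ga addr0 eqxx.
rewrite (@fsum_finset _ P); last by move=> a ?; left.
rewrite [X in _ = _ + X](@fsum_finset _ P); last by move=> a ?; right.
by rewrite -fsbig_split//; apply: eq_fsbigr => a _; exact: mulrDl.
Qed.

Lemma mul_coefA f g h : f \in is_puiseux -> g \in is_puiseux ->
  h \in is_puiseux ->
  mul_coef f (mul_coef g h) = mul_coef (mul_coef f g) h.
Proof.
move=> Pf Pg Ph; apply/funext => q; rewrite /mul_coef.
have [m1 m10 [N1 [] fS]] : exists2 m, (0 < m)%N & exists N,
    [/\ supp_in m N f, supp_in m N g & supp_in m N h].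
  have [m m0 [N fS gS]] := supp_in_common Pf Pg.
  have /is_puiseuxP[m' m'0 [N' hS]] := Ph.
  exists (m * m')%N; first by rewrite muln_gt0 m0.
  exists (Num.min (- `|N| * m'%:Z) (- `|N'| * m%:Z)); split.
  - by apply: supp_in_widen fS => //; rewrite ge_min lexx.
  - by apply: supp_in_widen gS => //; rewrite ge_min lexx.
  - by rewrite mulnC; apply: supp_in_widen hS => //; rewrite ge_min lexx orbT.
move=> gS hS.
transitivity (\sum_(a \in [set: rat]) \sum_(b \in [set: rat])
    f a * g (b - a) * h (q - b)).
  apply: eq_fsbigr => a _; rewrite mulr_fsumr.
  rewrite (reindex_fsbigT (fun b => b - a)); last first.
    by exists (fun b => b + a) => b; rewrite ?subrK ?addrK.
  by apply: eq_fsbigr => b _; rewrite mulrA opprB addrA subrK.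
transitivity (\sum_(b \in [set: rat]) \sum_(a \in [set: rat])
    f a * g (b - a) * h (q - b)); last first.
  by apply: eq_fsbigr => b _; rewrite mulr_fsuml.
apply: (exchange_fsum
  (finite_lattice m1 N1 (q * m1%:R - N1%:~R - N1%:~R))
  (finite_lattice m1 (N1 + N1) (q * m1%:R - N1%:~R))) => a b.
rewrite mulf_eq0 negb_or => /andP[/(mul_coef_supp fS gS)].
move=> [k [l [Nk Nl aE _ bE]]] /hS[j Nj qbE].
have mN0 : (m1%:R : rat) != 0 by rewrite pnatr_eq0 -lt0n.
have qE : q * m1%:R = k%:~R + l%:~R + j%:~R.
  by rewrite -(subrK b q) qbE bE mulrDl !mulfVK// intrD addrC.
have [Nk' Nl' Nj'] : [/\ (N1%:~R : rat) <= k%:~R, (N1%:~R : rat) <= l%:~R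
    & (N1%:~R : rat) <= j%:~R] by split; rewrite ler_int.
split.
- by exists k; split=> //; rewrite qE; lra.
- by exists (k + l); split; [exact: lerD|rewrite qE intrD; lra|].
Qed.

Definition puiseux_one : puiseux := Puiseux one_is_puiseux.
Definition puiseux_mul (a b : puiseux) : puiseux :=
  Puiseux (mul_is_puiseux (valP a) (valP b)).

Lemma puiseux_mulA : associative puiseux_mul.
Proof. by move=> a b c; apply/val_inj/mul_coefA; exact: valP. Qed.
Lemma puiseux_mulC : commutative puiseux_mul.
Proof. by move=> a b; apply/val_inj/mul_coefC. Qed.
Lemma puiseux_mul1 : left_id puiseux_one puiseux_mul.
Proof. by move=> a; apply/val_inj/mul_coef1. Qed.
Lemma puiseux_mulDl : left_distributive puiseux_mul +%R.
Proof. by move=> a b c; apply/val_inj/mul_coefDl; exact: valP. Qed.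
Lemma puiseux_one_neq0 : puiseux_one != 0.
Proof.
apply/eqP => /(congr1 (fun a : puiseux => a 0)).
by move/eqP; rewrite /= /one_coef eqxx oner_eq0.
Qed.

HB.instance Definition _ := GRing.Zmodule_isComNzRing.Build puiseux
  puiseux_mulA puiseux_mulC puiseux_mul1 puiseux_mulDl puiseux_one_neq0.

(* the lowest exponent with nonzero coefficient (see pvalP); junk value 0 on
   the zero series *)
Definition pval (a : puiseux) : rat :=
  xget 0 [set q | a q != 0 /\ forall r, r < q -> a r = 0].

Definition plead (a : puiseux) : R := a (pval a).

Definition plt (a b : puiseux) : Prop := 0 < plead (b - a).
Definition ple (a b : puiseux) : Prop := a = b \/ plt a b.

Lemma pvalP (a : puiseux) : a != 0 ->
  a (pval a) != 0 /\ forall r, r < pval a -> a r = 0.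
Proof.
move=> a0.
suff: exists q, [set q | a q != 0 /\ forall r, r < q -> a r = 0] q.
  exact: xgetPex.
have /is_puiseuxP[m m0 [N aS]] := valP a.
have mN0 : (m%:R : rat) != 0 by rewrite pnatr_eq0 -lt0n.
have [q aq] : exists q, a q != 0.
  apply: contrapT => /forallNP aN; move/eqP: a0; apply; apply/val_inj/funext.
  by move=> q; apply/eqP; apply: contraT => /aN.
pose P (i : nat) := a ((N + i%:Z)%:~R / m%:R) != 0.
have PE r : a r != 0 -> exists2 i, P i & r = (N + i%:Z)%:~R / m%:R.
  move=> ar; have [k Nk rE] := aS _ ar; exists `|k - N|%N.
    by rewrite /P gez0_abs ?subr_ge0// subrKC -rE.
  by rewrite gez0_abs ?subr_ge0// subrKC.
have exP : exists i, P i by have [i] := PE _ aq; exists i.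
exists ((N + (ex_minn exP)%:Z)%:~R / m%:R).
case: ex_minnP => i Pi imin; split=> // r ri.
apply/eqP; apply: contraTT ri => /PE[j /imin ij ->].
by rewrite -leNgt ler_pM2r ?invr_gt0 ?ltr0n// ler_int lerD2l.
Qed.

End Puiseux.

(* S = set0 contributes the harmless condition 0 <= 1 *)
Definition Sigma_star (R : realType) (n : nat) (A : 'M[puiseux R]_n) : Prop :=
  [/\ A^T = A,
      forall i j, A i j != 0 &
      forall S : {set 'I_n},
        ple 0 (\det (mxsub (@enum_val _ (mem S)) (@enum_val _ (mem S)) A))].

Definition trop_Sigma_star (R : realType) (n : nat) (A : 'M[rat]_n) : Prop :=
  exists2 B : 'M[puiseux R]_n, Sigma_star B & A = map_mx (@pval R) B.

(* Since there is no tropical zero in rat, the inner dimension is positive;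
   min is idempotent, so starting the iteration at the term k = 0 is harmless. *)
Definition trop_mulmx (m p n : nat)
    (A : 'M[rat]_(m, p.+1)) (B : 'M[rat]_(p.+1, n)) : 'M[rat]_(m, n) :=
  \matrix_(i, j) \big[Num.min/A i ord0 + B ord0 j]_(k < p.+1) (A i k + B k j).

Definition trop_qform (n : nat) (A : 'M[rat]_n.+1) (y : 'cV[rat]_n.+1) : rat :=
  trop_mulmx (trop_mulmx y^T A) y ord0 ord0.

Definition trop_psd_form (R : realType) (n : nat)
    (q : 'cV[rat]_n.+1 -> rat) : Prop :=
  exists2 A : 'M[rat]_n.+1, trop_Sigma_star R A & q = trop_qform A.

Section Subdivision.
Variables (R : realType) (n : nat).

Definition lifted_points (A : 'M[rat]_n) : set ('rV[R]_n * R^o) :=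
  [set p | exists i j : 'I_n, (i <= j)%N /\
     p = (delta_mx 0 i + delta_mx 0 j, ratr (A i j))].

Definition lifted_polytope (A : 'M[rat]_n) : set ('rV[R]_n * R^o) :=
  smallest (@convex_set R _) (lifted_points A).

(* lower faces: faces having an inner normal vector (w, c) with c > 0 *)
Definition lower_face (P F : set ('rV[R]_n * R^o)) : Prop :=
  exists (w : 'rV[R]_n) (c : R), 0 < c /\
    let h (p : 'rV[R]_n * R^o) := (\sum_(i < n) w 0 i * p.1 0 i) + c * p.2 in
    F = [set p | P p /\ forall p', P p' -> h p <= h p'].

Definition cell (A : 'M[rat]_n) (C : set 'rV[R]_n) : Prop :=
  exists2 F, lower_face (lifted_polytope A) F & C = fst @` F.

Definition maximal_cell (A : 'M[rat]_n) (C : set 'rV[R]_n) : Prop :=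
  cell A C /\ forall D, cell A D -> C `<=` D -> D = C.

Definition trivial_subdivision (A : 'M[rat]_n) : Prop :=
  exists! C, maximal_cell A C.

End Subdivision.

(* Main.v *)
(* All three conditions are equivalent to a_ii + a_jj <= 2 a_ij for all i, j.
   For trop(Sigma_n^* ), necessity is the sign of the leading coefficient of the
   2x2 principal minors; sufficiency is a lift with large constants on the
   diagonal.  The condition depends only on the tropical form, because a_ii is
   recovered by making y_i very negative, and a_ij is then bounded by evaluating
   at y_i = - a_ii / 2.  For the subdivision, the inequality says that no lifted
   point lies below the affine function interpolating the lifted vertices 2 e_i,
   whose lower face then projects onto the whole simplex.  Conversely every 2 e_i
   lies in some cell; if there is a single maximal cell it contains all of them,
   and the affine function supporting its face gives the inequalities. *)
(* perm comes first because its pval would otherwise hide the valuation. *)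
From mathcomp Require Import perm.
Require Import Defs.
From mathcomp Require Import all_boot all_order all_algebra.
From mathcomp Require Import all_classical all_reals all_analysis.
From mathcomp Require Import ring lra.

Set Implicit Arguments.
Unset Strict Implicit.
Unset Printing Implicit Defensive.

Import Order.TTheory GRing.Theory Num.Theory.
Local Open Scope classical_set_scope.
Local Open Scope ring_scope.

Definition midpoint_dominated (n : nat) (A : 'M[rat]_n) : Prop :=
  forall i j, A i i + A j j <= A i j *+ 2.

(** * Leading coefficients and monomials of Puiseux series *)

Section PuiseuxLead.
Variable R : realType.
Implicit Types (a b : puiseux R) (p q r : rat) (c d : R).

Lemma pval_eq a q : a q != 0 -> (forall r, r < q -> a r = 0) -> pval a = q.
Proof.
move=> aq0 alt; have a0 : a != 0.
  by apply: contraNneq aq0 => ->; rewrite -[X in X == _]/0.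
have [av0 av] := pvalP a0; have [vq|qv|//] := ltgtP (pval a) q.
  by rewrite (alt _ vq) eqxx in av0.
by rewrite (av _ qv) eqxx in aq0.
Qed.

(** Signs are read at an exponent [q] below which the series vanishes, so that the valuation of a
    minor never has to be computed. *)
Lemma plt0_coef a q : (forall r, r < q -> a r = 0) -> 0 < a q -> plt 0 a.
Proof.
move=> alt aq; rewrite /plt subr0 /plead (@pval_eq _ q) //.
exact: lt0r_neq0.
Qed.

Lemma ple0_coef a q : (forall r, r < q -> a r = 0) -> ple 0 a -> 0 <= a q.
Proof.
move=> alt [<-|]; first by rewrite -[X in _ <= X]/0.
have [->//|aq0] := eqVneq (a q) 0.
by rewrite /plt subr0 /plead (@pval_eq _ q) // => /ltW.
Qed.

(** In the Cauchy product every index other than [p] meets a vanishing coefficient of [a] or of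
    [b]. *)
Lemma coefpM_lead a b p q :
  (forall r, r < p -> a r = 0) -> (forall r, r < q -> b r = 0) ->
  (a * b) (p + q) = a p * b q.
Proof.
move=> alt blt; rewrite -[LHS]/(mul_coef a b (p + q)) /mul_coef.
rewrite (@fsum_finset _ _ [set p]) ?fsbig_set1 ?[p + q]addrC ?addrK //.
move=> r; have [rp|pr|//] := ltgtP r p; first by rewrite alt // mul0r eqxx.
by rewrite blt ?mulr0 ?eqxx // ltrBlDr ltrD2l.
Qed.

Lemma coefpM_lt a b p q :
  (forall r, r < p -> a r = 0) -> (forall r, r < q -> b r = 0) ->
  forall r, r < p + q -> (a * b) r = 0.
Proof.
move=> alt blt r rpq; rewrite -[LHS]/(mul_coef a b r) /mul_coef.
apply: fsbig1 => s _; have [sp|ps] := ltP s p; first by rewrite alt // mul0r.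
rewrite blt ?mulr0 // ltrBlDr; apply: lt_le_trans rpq _.
by rewrite addrC lerD2l.
Qed.

Lemma coefpB a b r : (a - b) r = a r - b r.
Proof. by []. Qed.

Lemma coefp_sum (I : finType) (F : I -> puiseux R) r :
  (\sum_i F i) r = \sum_i F i r.
Proof. exact: (big_morph (fun a : puiseux R => a r)). Qed.

Definition mono_coef c q : rat -> R := fun r => if r == q then c else 0.

Lemma mono_is_puiseux c q : mono_coef c q \in @is_puiseux R.
Proof.
apply/is_puiseuxP; exists `|denq q|%N; first by rewrite absz_gt0 denq_neq0.
exists (numq q) => r; rewrite /mono_coef; case: (eqVneq r q) => [-> _|_];
  last by rewrite eqxx.
exists (numq q) => //.
by rewrite -[_%:R]/(`|denq q|%N%:Z%:~R) absz_denq divq_num_den.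
Qed.

Definition mono c q : puiseux R := Puiseux (mono_is_puiseux c q).

Lemma monoE c q r : mono c q r = if r == q then c else 0.
Proof. by []. Qed.

Lemma monoM c d p q : mono c p * mono d q = mono (c * d) (p + q).
Proof.
apply/val_inj/funext => r /=; rewrite /mul_coef (@fsum_finset _ _ [set p]).
  rewrite fsbig_set1 /mono_coef eqxx subr_eq addrC.
  by case: ifP; rewrite ?mulr0.
by move=> s; rewrite /mono_coef; case: (eqVneq s p) => //; rewrite mul0r eqxx.
Qed.

Lemma mono1 : mono 1 0 = 1.
Proof.
apply/val_inj/funext => r /=; rewrite /mono_coef /one_coef.
by case: eqVneq.
Qed.

Lemma monoN c q : - mono c q = mono (- c) q.
Proof.
apply/val_inj/funext => r; rewrite -[LHS]/(- mono_coef c q r) /= /mono_coef.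
by case: eqVneq; rewrite ?oppr0.
Qed.

Lemma mono_sign (s : bool) c q : (-1) ^+ s * mono c q = mono ((-1) ^+ s * c) q.
Proof. by case: s; rewrite ?expr0 ?mul1r // expr1 !mulN1r monoN. Qed.

Lemma mono_prod k (c : 'I_k -> R) (q : 'I_k -> rat) :
  \prod_i mono (c i) (q i) = mono (\prod_i c i) (\sum_i q i).
Proof.
elim: k c q => [|k IH] c q; first by rewrite !big_ord0 mono1.
by rewrite !big_ord_recl IH monoM.
Qed.

Lemma det_mono k (c : 'I_k -> 'I_k -> R) (q : 'I_k -> 'I_k -> rat) r :
  \det (\matrix_(i, j) mono (c i j) (q i j)) r =
  \sum_(s : 'S_k) if r == \sum_i q i (s i)
                  then (-1) ^+ s * \prod_i c i (s i) else 0.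
Proof.
rewrite /determinant coefp_sum; apply: eq_bigr => s _.
under eq_bigr do rewrite mxE.
by rewrite mono_prod mono_sign monoE.
Qed.

End PuiseuxLead.

(** * Dominance of the identity permutation *)

Section DiagonalConstant.
Variables (R : realType) (c : R).

(** A permutation other than the identity moves some index, so at least one factor is 1. *)
Lemma prod_perm_neq1_le k (s : 'S_k) : 1 <= c -> s != 1%g ->
  \prod_i (if s i == i then c else 1) <= c ^+ k.-1.
Proof.
move=> c1 s1; have [i0 si0] : exists i, s i != i.
  apply/existsP; rewrite -negb_forall; apply: contra s1 => /forallP ss.
  by apply/eqP/perm.permP => i; rewrite perm1; apply/eqP.
rewrite (bigD1 i0) //= (negbTE si0) mul1r.
apply: (@le_trans _ _ (\prod_(i | i != i0) c)).
  apply: ler_prod => i _; case: ifP => _; last by rewrite ler01 c1.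
  by rewrite lexx (le_trans ler01 c1).
by rewrite prodr_const cardC1 card_ord.
Qed.

(** In the application [e] selects the permutations that reach the lowest exponent. The identity
    contributes [c ^+ k]; the others, fewer than [k!], contribute at most [c ^+ k.-1] each in
    absolute value. *)
Lemma dominant_perm_sum_gt0 k (e : 'S_k -> bool) : (k`!)%:R < c -> e 1%g ->
  0 < \sum_(s : 'S_k) (if e s then (-1) ^+ s *
         \prod_i (if s i == i then c else 1) else 0).
Proof.
move=> kc e1.
have c1 : 1 <= c by rewrite ltW // (le_lt_trans _ kc) // ler1n fact_gt0.
have c0 : 0 < c by exact: lt_le_trans c1.
rewrite (bigD1 (1%g : 'S_k)) //= e1 odd_perm1 expr0 mul1r.
under eq_bigr do rewrite perm1 eqxx.
rewrite prodr_const card_ord -[X in _ + X]opprK subr_gt0 -sumrN.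
case: k e kc e1 => [|l] e kc e1.
  rewrite big1 ?ltr01 // => s /eqP; case.
  by apply/perm.permP => -[].
apply: (@le_lt_trans _ _ (\sum_(s : 'S_l.+1) c ^+ l)); last first.
  rewrite sumr_const card_Sn exprS -mulr_natl ltr_pM2r //.
  exact: exprn_gt0.
apply: (@le_trans _ _ (\sum_(s : 'S_l.+1 | s != 1%g) c ^+ l)).
  apply: ler_sum => s s1; case: ifP => _; last by rewrite oppr0 exprn_ge0 // ltW.
  apply: le_trans (ler_norm _) _; rewrite normrN normrM normr_sign mul1r.
  rewrite ger0_norm; first exact: prod_perm_neq1_le.
  by apply: prodr_ge0 => i _; case: ifP => // _; exact: ltW.
by rewrite [leRHS](bigD1 (1%g : 'S_l.+1)) //= lerDr exprn_ge0 // ltW.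
Qed.

End DiagonalConstant.

(** * Principal minors and midpoint inequalities *)

Lemma det_mx22 (T : comNzRingType) (M : 'M[T]_2) :
  \det M = M 0 0 * M 1 1 - M 0 1 * M 1 0.
Proof.
rewrite (expand_det_row _ 0) !big_ord_recl big_ord0 addr0 /cofactor !det_mx11.
rewrite !mxE /= expr0 expr1 mul1r mulN1r mulrN.
by congr (_ * M _ _ - M _ _ * M _ _); apply/val_inj.
Qed.

Section TropSigma.
Variables (R : realType) (n : nat) (A : 'M[rat]_n).

Lemma midpoint_dominated_of_trop_Sigma_star :
  trop_Sigma_star R A -> midpoint_dominated A.
Proof.
case=> B [Bsym Bn0 Bpsd] -> i j; rewrite !mxE.
have [->|ij] := eqVneq i j; first by rewrite mulr2n.
have Bji : B j i = B i j by rewrite -[in LHS]Bsym mxE.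
(* [enum_val] lists [[set i; j]] in an unknown order, and the size of the minor is 2 only
   propositionally; hence a claim for any such [f] and [k]. *)
have detE k (f : 'I_k -> 'I_n) : k = 2 -> injective f ->
    (forall x, f x \in [set i; j]%SET) ->
    \det (mxsub f f B) = B i i * B j j - B i j * B i j.
  move=> k2; subst k => finj fij; rewrite det_mx22 !mxE.
  have : f 0 != f 1 by apply/eqP => /finj.
  have := fij 0; have := fij 1; rewrite !inE.
  case/orP=> /eqP -> /orP[] /eqP ->; rewrite ?eqxx // => _; rewrite Bji //.
  by rewrite [B j j * _]mulrC.
have := Bpsd [set i; j]%SET; rewrite detE; first last.
- by move=> x; exact: enum_valP.
- exact: enum_val_inj.
- by rewrite cards2 ij.
have vz x y := (pvalP (Bn0 x y)).2.
have lij := coefpM_lt (vz i j) (vz i j); have eij := coefpM_lead (vz i j) (vz i j).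
have lii := coefpM_lt (vz i i) (vz j j).
(* Otherwise the lowest term of the minor has exponent 2 val(b_ij), and its coefficient is minus a
   nonzero square. *)
rewrite leNgt mulr2n => /ple0_coef minor_ge0; apply/negP => lt_v.
have := minor_ge0 (pval (B i j) + pval (B i j)).
rewrite coefpB eij lii // sub0r oppr_ge0 => sq_le0.
have : 0 < B i j (pval (B i j)) * B i j (pval (B i j)).
  by rewrite -expr2 exprn_even_gt0 //= (pvalP (Bn0 i j)).1.
rewrite ltNge sq_le0 // => r rlt.
by rewrite coefpB lii ?lij ?subr0 // (lt_trans rlt).
Qed.

(* Lift to b_ij = t^a_ij off the diagonal and b_ii = c t^a_ii: the terms of lowest
   order in a principal minor have exponent sum_i a_ii, and for c > n! the
   identity permutation dominates among them. *)
Lemma trop_Sigma_star_of_midpoint_dominated :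
  A^T = A -> midpoint_dominated A -> trop_Sigma_star R A.
Proof.
move=> Asym Adom; pose c : R := (n`!).+1%:R.
have c0 : c != 0 by rewrite pnatr_eq0.
pose B := \matrix_(i, j) mono (if j == i then c else 1) (A i j).
have lead i j : B i j (A i j) != 0.
  by rewrite mxE monoE eqxx; case: ifP => // _; rewrite oner_eq0.
have low i j r : r < A i j -> B i j r = 0.
  by rewrite mxE monoE => /lt_eqF ->.
exists B; last first.
  by apply/matrixP => i j; rewrite mxE (pval_eq (lead i j) (@low i j)).
split.
- apply/matrixP => i j; rewrite !mxE eq_sym; congr mono.
  by rewrite -[in LHS]Asym mxE.
- move=> i j; by apply: contraNneq (lead i j) => ->; rewrite -[X in X == _]/0.
move=> S; right; set f := @enum_val _ _.
have kn : (#|mem S| <= n)%N by rewrite -[leqRHS]card_ord; exact: max_card.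
have finj : injective f by exact: enum_val_inj.
move: #|mem S| f kn finj => k f kn finj.
have -> : mxsub f f B =
    \matrix_(i, j) mono (if j == i then c else 1) (A (f i) (f j)).
  by apply/matrixP => i j; rewrite !mxE (inj_eq finj).
(* Sum the midpoint inequalities over the pairs [f i], [f (s i)], and reindex the second diagonal
   sum by [s]. *)
have exp_ge (s : 'S_k) : \sum_i A (f i) (f i) <= \sum_i A (f i) (f (s i)).
  rewrite -(ler_pMn2r (_ : (0 < 2)%N)) // -[leRHS]sumrMnl.
  apply: le_trans (ler_sum _ (fun i _ => Adom (f i) (f (s i)))).
  rewrite big_split /= mulr2n lerD2l (reindex_inj (@perm_inj _ s)) //.
apply: (@plt0_coef _ _ (\sum_i A (f i) (f i))) => [r rlt|]; rewrite det_mono.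
  by apply: big1 => s _; rewrite lt_eqF // (lt_le_trans rlt).
apply: dominant_perm_sum_gt0.
  by rewrite ltr_nat ltnS leq_fact.
by apply/eqP/eq_bigr => i _; rewrite perm1.
Qed.

End TropSigma.

(** * From a tropical quadratic form back to its matrix *)

Section TropForm.
Variable n : nat.
Implicit Types (A : 'M[rat]_n.+1) (x : rat).

Lemma le_trop_qformP A (y : 'cV[rat]_n.+1) x :
  reflect (forall i j, x <= y i 0 + A i j + y j 0) (x <= trop_qform A y).
Proof.
apply: (iffP idP) => [|xle].
  rewrite /trop_qform mxE => /bigmin_geP[_ +] i j => /(_ j isT).
  rewrite mxE -lerBlDr => /bigmin_geP[_ /(_ i isT)].
  by rewrite mxE lerBlDr.
have row j : x - y j 0 <= (trop_mulmx y^T A) 0 j.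
  rewrite mxE; apply/bigmin_geP; split=> [|i _]; rewrite mxE lerBlDr; exact: xle.
by rewrite /trop_qform mxE; apply/bigmin_geP; split=> [|j _]; rewrite -lerBlDr.
Qed.

End TropForm.

(** Take y_i = -M and 0 elsewhere, with [M] above every a_ii - a_kl: the term (i, i) drops by 2M,
    any other by at most M. This serves both to read a_ii off the form and to find a cell containing
    2 e_i. *)
Lemma isolating_vector n (A : 'M[rat]_n) (i : 'I_n) :
  exists y : 'cV[rat]_n, forall k l,
    y i 0 + A i i + y i 0 <= y k 0 + A k l + y l 0.
Proof.
pose M := \sum_k \sum_l `|A i i - A k l|.
have M0 : 0 <= M by apply: sumr_ge0 => k _; exact: sumr_ge0.
have MA k l : A i i - A k l <= M.
  apply: le_trans (ler_norm _) _.
  rewrite /M (bigD1 k) //= (bigD1 l) //= -addrA lerDl.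
  by rewrite addr_ge0 // sumr_ge0 // => ? _; rewrite sumr_ge0.
exists (\col_k if k == i then - M else 0) => k l; rewrite !mxE eqxx.
by have := MA k l; case: (eqVneq k i) => [->|_]; case: (eqVneq l i) => [->|_]; lra.
Qed.

(** Distinct matrices can define the same form, so the PSD matrix [B] behind the form of [A] need
    not be [A]. *)
Lemma trop_qform_midpoint_dominated n (A B : 'M[rat]_n.+1) :
  trop_qform A = trop_qform B -> midpoint_dominated B -> midpoint_dominated A.
Proof.
move=> AB Bdom i j.
have diag k : A k k <= B k k.
  have [y yA] := isolating_vector A k.
  have /le_trop_qformP : y k 0 + A k k + y k 0 <= trop_qform B y.
    by rewrite -AB; apply/le_trop_qformP.
  by move=> /(_ k k); lra.
(* At this [y] all terms of the form of [B] are nonnegative, hence also those of [A], which reads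
   b_ii + b_jj <= 2 a_ij. *)
pose y : 'cV[rat]_n.+1 := \col_k (- (B k k / 2)).
have /le_trop_qformP/(_ i j) : 0 <= trop_qform A y.
  rewrite AB; apply/le_trop_qformP => k l; rewrite !mxE.
  by have := Bdom k l; lra.
by rewrite !mxE; have := diag i; have := diag j; lra.
Qed.

Lemma trop_psd_formP (R : realType) n (A : 'M[rat]_n.+1) : A^T = A ->
  trop_psd_form R (trop_qform A) <-> midpoint_dominated A.
Proof.
move=> Asym; split.
  move=> [B /midpoint_dominated_of_trop_Sigma_star Bdom AB].
  exact: trop_qform_midpoint_dominated AB Bdom.
by exists A => //; exact: trop_Sigma_star_of_midpoint_dominated.
Qed.

(** * Convex sets and supporting functionals *)

Section Convexity.
Variables (R : realType) (M : lmodType R).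
Implicit Types X Y : set M.

Lemma convex_set_openP X : @convex_set R M X <->
  forall x y (t : R), 0 < t -> t < 1 -> X x -> X y -> X (t *: x + (1 - t) *: y).
Proof.
split=> [/convex_setW cX x y t t0 t1 Xx Xy|cX].
  have := cX x y; rewrite !inE => /(_ Xx Xy (Itv01 (ltW t0) (ltW t1)) t0 t1).
  by rewrite inE.
by apply/convex_setW => x y; rewrite !inE => Xx Xy k k0 k1; rewrite inE; exact: cX.
Qed.

Lemma convex_smallest X : @convex_set R M (smallest (@convex_set R M) X).
Proof.
apply/convex_set_openP => x y t t0 t1 hx hy Y [cY XY].
by move/convex_set_openP: (cY); apply=> //; [exact: hx|exact: hy].
Qed.

End Convexity.

Section Height.
Variables (R : realType) (n : nat).
Local Notation V := ('rV[R]_n * R^o)%type.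
Implicit Types (w : 'rV[R]_n) (c m t : R) (p : V).

(** No sign is imposed on [c]: besides the functionals of lower faces, [c = 0] is used to isolate
    the points over a vertex. *)
Definition height w c p : R := \sum_(i < n) w 0 i * p.1 0 i + c * p.2.

Lemma height_conv w c p q t :
  height w c (t *: p + (1 - t) *: q) = t * height w c p + (1 - t) * height w c q.
Proof.
rewrite /height /= -![_ *: (_ : R^o)]/(_ * _) !mulrDr !mulr_sumr addrACA.
rewrite -big_split /=.
congr (_ + _); last by ring.
by apply: eq_bigr => i _; rewrite !mxE; ring.
Qed.

Lemma height_lift w c i j (z : R) :
  height w c (delta_mx 0 i + delta_mx 0 j, z) = w 0 i + w 0 j + c * z.
Proof.
rewrite /height /=; congr (_ + _).
under eq_bigr do rewrite !mxE !eqxx /= mulrDr.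
rewrite big_split /=; congr (_ + _).
  by rewrite (bigD1 i) //= eqxx mulr1 big1 ?addr0 // => k /negbTE ->; rewrite mulr0.
by rewrite (bigD1 j) //= eqxx mulr1 big1 ?addr0 // => k /negbTE ->; rewrite mulr0.
Qed.

(* On a proper convex combination the bound m is attained only if both ends
   attain it: this is how a face inherits a convex property from its vertices. *)
Lemma convex_halfspace_face w c m (X : set V) : @convex_set R V X ->
  @convex_set R V [set p | m <= height w c p /\ (height w c p = m -> X p)].
Proof.
move=> /convex_set_openP cX; apply/convex_set_openP => p q t t0 t1.
move=> [mp Xp] [mq Xq] /=; rewrite height_conv; split; first by nra.
move=> hE; apply: cX => //; [apply: Xp|apply: Xq]; nra.
Qed.

End Height.

(** * Cells of the induced subdivision *)

Section Cells.
Variables (R : realType) (n : nat) (A : 'M[rat]_n).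
Local Notation V := ('rV[R]_n * R^o)%type.
Local Notation e i j := (delta_mx 0 i + delta_mx 0 j : 'rV[R]_n).
Local Notation lift i j := ((e i j, ratr (A i j)) : V).
Local Notation P := (@lifted_polytope R n A).

Definition height_face (w : 'rV[R]_n) (c : R) : set V :=
  [set p | P p /\ forall q, P q -> height w c p <= height w c q].

Lemma cellP (C : set 'rV[R]_n) :
  cell A C <-> exists w c, 0 < c /\ C = fst @` height_face w c.
Proof.
split=> [[F [w [c [c0 FE]]] ->]|[w [c [c0 ->]]]].
  by exists w, c; split; rewrite // FE.
by exists (height_face w c) => //; exists w, c.
Qed.

Lemma lifted_polytope_sub (X : set V) : @convex_set R V X ->
  (forall i j, X (lift i j)) -> P `<=` X.
Proof. by move=> cX Xl; apply: smallest_sub => // _ [i [j [_ ->]]]. Qed.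

Lemma height_face_convex w c : @convex_set R V (height_face w c).
Proof.
apply/convex_set_openP => p q t t0 t1 [Pp hp] [Pq hq]; split.
  by move/convex_set_openP: (@convex_smallest R V (lifted_points A)); apply.
move=> r Pr; rewrite height_conv; have := hp _ Pr; have := hq _ Pr; nra.
Qed.

Lemma convex_fst_image (F : set V) :
  @convex_set R V F -> @convex_set R 'rV[R]_n (fst @` F).
Proof.
move=> /convex_set_openP cF; apply/convex_set_openP.
move=> _ _ t t0 t1 [p Fp <-] [q Fq <-].
by exists (t *: p + (1 - t) *: q) => //; exact: cF.
Qed.

Lemma convex_fst_preimage (X : set 'rV[R]_n) :
  @convex_set R 'rV[R]_n X -> @convex_set R V (fst @^-1` X).
Proof.
move=> /convex_set_openP cX; apply/convex_set_openP => p q t t0 t1 Xp Xq.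
exact: cX.
Qed.

(** Among the lifted points, -x_i attains its minimum -2 only over 2 e_i; [convex_halfspace_face]
    carries the last coordinate found there to the whole polytope. *)
Lemma polytope_over_vertex i p : P p -> p.1 = e i i -> p.2 = ratr (A i i).
Proof.
pose X : set V := [set p | p.2 = ratr (A i i)].
have cX : @convex_set R V X.
  apply/convex_set_openP => x y t _ _; rewrite /X /= => -> ->.
  by rewrite -scalerDl subrKC scale1r.
move=> /(lifted_polytope_sub
  (@convex_halfspace_face R n (- delta_mx 0 i) 0 (- 2) X cX)).
have lower k l : let p := lift k l in
    - 2 <= height (- delta_mx 0 i) 0 p /\
    (height (- delta_mx 0 i) 0 p = - 2 -> X p).
  rewrite /= height_lift mul0r addr0 !mxE eqxx /=.
  case: (eqVneq k i) => [->|ki]; case: (eqVneq l i) => [->|li] /=; split=> //; lra.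
move=> /(_ lower) [_ Xp] p1; apply: Xp.
by case: p p1 => v z /= ->; rewrite height_lift !mxE !eqxx /=; lra.
Qed.

Hypothesis Asym : A^T = A.

Lemma lift_in_polytope i j : P (lift i j).
Proof.
apply: sub_gen_smallest; have [ij|/ltnW ji] := leqP i j; first by exists i, j.
by exists j, i; split; rewrite // addrC -[in LHS]Asym mxE.
Qed.

(** By [convex_halfspace_face], the minimal height is reached only over the hull [K]. A cell is thus
    determined by which of the finitely many e_i + e_j it contains. *)
Lemma cell_eq_hull (C : set 'rV[R]_n) : cell A C ->
  C = smallest (@convex_set R 'rV[R]_n) [set v | C v /\ exists i j, v = e i j].
Proof.
move=> /cellP[w [c [c0 CE]]]; set K := smallest _ _.
have cK : @convex_set R 'rV[R]_n K by exact: convex_smallest.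
apply/seteqP; split; last first.
  apply: smallest_sub => [|v []//]; rewrite CE.
  exact/convex_fst_image/height_face_convex.
move=> v; rewrite {1}CE => -[p [Pp hp] <-].
pose m := height w c p.
have := @convex_halfspace_face R n w c m _ (convex_fst_preimage cK).
move=> /lifted_polytope_sub/(_ _ _ Pp)[]; last by move=> _; exact.
move=> i j; split; first by apply: hp; exact: lift_in_polytope.
move=> hij; apply: sub_gen_smallest; split; last by exists i, j.
rewrite CE; exists (lift i j) => //; split; first exact: lift_in_polytope.
by rewrite hij.
Qed.

Definition cell_indices (C : set 'rV[R]_n) : {set 'I_n * 'I_n} :=
  [set ij | `[< C (e ij.1 ij.2) >]]%SET.

Lemma cell_indices_sub C D : C `<=` D -> (cell_indices C \subset cell_indices D)%SET.
Proof.
move=> CD; apply/fintype.subsetP => ij; rewrite !finset.in_set => /asboolP Cij.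
exact/asboolP/CD.
Qed.

Lemma cell_indices_inj (C D : set 'rV[R]_n) : cell A C -> cell A D ->
  cell_indices C = cell_indices D -> C = D.
Proof.
move=> /cell_eq_hull CE /cell_eq_hull DE CD; rewrite CE DE; congr smallest.
have CDij i j : C (e i j) <-> D (e i j).
  have := congr1 (fun X : {set _} => (i, j) \in X) CD.
  rewrite /cell_indices !finset.in_set /=.
  by move=> ij; split=> /asboolP Xij; apply/asboolP; [rewrite -ij|rewrite ij].
apply/predeqP => v; split=> -[Cv [i [j vE]]]; split;
  try (by exists i, j); by move: Cv; rewrite vE => /CDij.
Qed.

(** Among the cells containing [C], one with the most index pairs is maximal: a larger cell has the
    same pairs, hence is equal to it. *)
Lemma maximal_cell_above (C : set 'rV[R]_n) : cell A C ->
  exists2 D, maximal_cell A D & C `<=` D.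
Proof.
move=> cellC.
pose Q k := `[< exists D : set 'rV[R]_n,
  [/\ cell A D, C `<=` D & #|cell_indices D| = k] >].
have exQ : exists k, Q k.
  by exists #|cell_indices C|; apply/asboolP; exists C; split.
have boundQ k : Q k -> (k <= #|{: 'I_n * 'I_n}|)%N.
  by move=> /asboolP[D [_ _ <-]]; exact: max_card.
have [k Qk kmax] := ex_maxnP exQ boundQ; have /asboolP[D [cellD CD Dk]] := Qk.
exists D => //; split=> // E cellE DE; apply/esym/cell_indices_inj => //.
apply/eqP; rewrite eqEcard cell_indices_sub //= Dk; apply: kmax; apply/asboolP.
by exists E; split=> // x /CD /DE.
Qed.

(** With [c = 1] the height of a lifted point is y_k + y_l + a_kl, a term of the tropical form, so
    the isolating vector makes 2 e_i minimal. *)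
Lemma vertex_in_cell i : exists2 C : set 'rV[R]_n, cell A C & C (e i i).
Proof.
have [y yA] := isolating_vector A i.
pose w : 'rV[R]_n := \row_k ratr (y k 0).
exists (fst @` height_face w 1); first by apply/cellP; exists w, 1.
exists (lift i i) => //; split; first exact: lift_in_polytope.
pose m := height w 1 (lift i i).
(* With [setT] the equality clause is vacuous, and only the lower bound passes to the polytope. *)
have cT : @convex_set R V setT by apply/convex_set_openP.
have := @convex_halfspace_face R n w 1 m _ cT.
move=> /lifted_polytope_sub sub q Pq; apply: (sub _ _ Pq).1 => k l; split=> //.
rewrite /m !height_lift !mul1r !mxE -!rmorphD ler_rat.
by have := yA k l; lra.
Qed.

Lemma trivial_subdivision_midpoint_dominated :
  trivial_subdivision R A -> midpoint_dominated A.
Proof.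
move=> [C [[cellC _] Cuniq]].
have Cvertex i : C (e i i).
  have [D cellD Di] := vertex_in_cell i.
  have [E maxE DE] := maximal_cell_above cellD.
  by rewrite (Cuniq _ maxE); exact: DE.
move: cellC => /cellP[w [c [c0 CE]]].
have diag i j : w 0 i + w 0 i + c * ratr (A i i) <=
    w 0 i + w 0 j + c * ratr (A i j).
  have := Cvertex i; rewrite CE => -[p [Pp hp] p1].
  have := polytope_over_vertex Pp p1; have := hp _ (lift_in_polytope i j).
  by case: p p1 {Pp hp} => v z /= -> + zE; rewrite zE !height_lift.
(* In the sum of the two inequalities the [w] terms cancel, and c > 0 can be divided out. *)
move=> i j; have := diag i j; have := diag j i.
have -> : A j i = A i j by rewrite -[in LHS]Asym mxE.
rewrite -(ler_rat R) raddfD /= raddfMn /= mulr2n; nra.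
Qed.

Lemma midpoint_dominated_trivial_subdivision :
  midpoint_dominated A -> trivial_subdivision R A.
Proof.
(* With this [w], [height w 1] is the elevation above the linear function with value a_kk at 2
   e_k. *)
move=> Adom; pose w : 'rV[R]_n := \row_k (- (ratr (A k k) / 2)).
have h_lift i j : 0 <= height w 1 (lift i j).
  rewrite height_lift !mxE; have := Adom i j.
  by rewrite -(ler_rat R) raddfD /= raddfMn /= mulr2n; lra.
have h_vertex i : height w 1 (lift i i) = 0 by rewrite height_lift !mxE; lra.
have hP p : P p -> 0 <= height w 1 p.
  have cT : @convex_set R V setT by apply/convex_set_openP.
  have := @convex_halfspace_face R n w 1 0 _ cT.
  by move=> /lifted_polytope_sub sub /sub[].
have vertexF i : height_face w 1 (lift i i).
  by split=> [|q Pq]; [exact: lift_in_polytope|rewrite h_vertex; exact: hP].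
(* Since e_i + e_j is the midpoint of 2 e_i and 2 e_j, a cell containing all vertices covers the
   projection of the polytope. *)
have PF : fst @` P `<=` fst @` height_face w 1.
  move=> _ [p Pp <-].
  apply: (@lifted_polytope_sub (fst @^-1` (fst @` height_face w 1)) _ _ p Pp)
    => [|i j].
    exact/convex_fst_preimage/convex_fst_image/height_face_convex.
  have half (v : 'rV[R]_n) : 2^-1 *: (v + v) = v.
    by rewrite -[v + v](scaler_nat 2 v) scalerA mulVf ?scale1r // pnatr_eq0.
  have mid : 2^-1 *: e i i + (1 - 2^-1) *: e j j = e i j.
    by rewrite (_ : 1 - 2^-1 = 2^-1 :> R); [rewrite !half|lra].
  rewrite /preimage /= -mid.
  have /convex_set_openP := convex_fst_image (@height_face_convex w 1).
  by apply; [lra|lra|exists (lift i i)|exists (lift j j)].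
have cellC0 : cell A (fst @` height_face w 1) by apply/cellP; exists w, 1.
have cell_sub (D : set 'rV[R]_n) : cell A D -> D `<=` fst @` height_face w 1.
  by move=> /cellP[w' [c [_ ->]]] _ [p [Pp _] <-]; apply: PF; exists p.
exists (fst @` height_face w 1); split; first split=> // D cellD CD.
  by apply/seteqP; split; first exact: cell_sub.
by move=> D [cellD maxD]; apply: maxD => //; exact: cell_sub.
Qed.

End Cells.

Theorem theorem3p1 (R : realType) (n : nat) (A : 'M[rat]_n.+1) (hA : A^T%R = A) :
  (trop_psd_form R (trop_qform A) <-> trop_Sigma_star R A) /\
  (trop_psd_form R (trop_qform A) <-> trivial_subdivision R A).
Proof.
rewrite (trop_psd_formP R hA); split; split.
- exact: trop_Sigma_star_of_midpoint_dominated.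
- exact: midpoint_dominated_of_trop_Sigma_star.
- exact: midpoint_dominated_trivial_subdivision.
- exact: trivial_subdivision_midpoint_dominated.
Qed.
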